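(* Let $n,k\ge 3$ be integers. Then the graph $C_n\times C_k$ is geometrically realized in $\mathbb{R}^4$ without hidden symmetries by the $1$-skeleton of the boundary complex $B(P^4_{n,k})$ of the $n,k$-duoprism $P^4_{n,k}$, and the toroidal quadrangulation $Q_{n,k}$ is geometrically realized in $\mathbb{R}^4$ without hidden symmetries in the $2$-skeleton of $B(P^4_{n,k})$ (by the $2$-polyhedron $\hat Q_{n,k}$). That is: every automorphism of the graph $C_n\times C_k$ is induced, under the vertex correspondence $(i,j)\mapsto M_{ij}$, by a Euclidean symmetry of the $1$-skeleton of $B(P^4_{n,k})$; and every combinatorial cellular automorphism of $Q_{n,k}$ is induced, under the same vertex correspondence, by a Euclidean symmetry of $\hat Q_{n,k}$.
   Context: $C_n$ is the simple cycle graph of length $n$, with vertices labelled by $i\in\mathbb{Z}/n$ and edges $\{i,i+1\}$. The Cartesian product $G_1\times G_2$ of graphs has vertex set $V(G_1)\times V(G_2)$, with $(u_1,u_2)$ adjacent to $(v_1,v_2)$ iff either $u_1=v_1$ and $u_2v_2$ is an edge of $G_2$, or $u_2=v_2$ and $u_1v_1$ is an edge of $G_1$. $Q_{n,k}$ is the quadrangulation of the $2$-torus obtained from the natural embedding of $C_n\times C_k$ in the torus as $n$ parallels and $k$ meridians (or vice versa). As an abstract $2$-complex its vertices and edges are those of $C_n\times C_k$, and its $nk$ faces are the quadrilaterals with consecutive vertices $(i,j),(i+1,j),(i+1,j+1),(i,j+1)$, for $i\in\mathbb{Z}/n$, $j\in\mathbb{Z}/k$. An automorphism of a complex is a bijection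 of its vertex set to itself that maps the vertex set of each cell to the vertex set of a cell. The $n,k$-duoprism $P^4_{n,k}$ is the Cartesian product of a regular $n$-gon and a regular $k$-gon, namely the convex hull in $\mathbb{R}^4$ of the $nk$ points $$M_{ij}=\left(\cos\tfrac{2\pi i}{n},\ \sin\tfrac{2\pi i}{n},\ \cos\tfrac{2\pi j}{k},\ \sin\tfrac{2\pi j}{k}\right),\qquad 0\le i\le n-1,\ 0\le j\le k-1,$$ which is a $4$-polytope with vertices $M_{ij}$. $B(P^4_{n,k})$ is its boundary complex. The $1$-skeleton of $B(P^4_{n,k})$ is the graph $C_n\times C_k$ (via $(i,j)\mapsto M_{ij}$), and the $2$-skeleton consists of a realization $\hat Q_{n,k}$ of $Q_{n,k}$ (whose faces are the quadrilaterals $M_{i,j}M_{i+1,j}M_{i+1,j+1}M_{i,j+1}$, indices mod $n$ and mod $k$) together with $n$ further $k$-gons and $k$ further $n$-gons. A Euclidean symmetry of such a polyhedron is an isometry of $\mathbb{R}^4$ (reflections allowed) leaving the polyhedron, with its cell structure, invariant. A geometric realization of a complex $K$ by a polyhedron is without hidden symmetries if each automorphism of $K$ is induced (on the vertices) by some Euclidean symmetry of that polyhedron. *)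

(* Defs.v *)
From HB Require Import structures.
From mathcomp Require Import all_boot all_order all_algebra perm.
From mathcomp Require Import all_classical all_reals all_analysis.

Set Implicit Arguments.
Unset Strict Implicit.
Unset Printing Implicit Defensive.

Import Order.TTheory GRing.Theory Num.Theory.

(* The vertices of the cycle are 'I_n, and ordS is i |-> i + 1 mod n. *)
Definition cycle_adj (n : nat) : rel 'I_n :=
  fun i j => (j == ordS i) || (i == ordS j).

Definition cart_prod (T1 T2 : finType) (e1 : rel T1) (e2 : rel T2) :
    rel (T1 * T2) :=
  fun u v => (u.1 == v.1) && e2 u.2 v.2 || (u.2 == v.2) && e1 u.1 v.1.

Definition torus_graph (n k : nat) : rel ('I_n * 'I_k) :=
  cart_prod (@cycle_adj n) (@cycle_adj k).

(* A finite complex on the vertex set T: K d is the set of the vertex sets of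
   the d-dimensional cells. *)
Definition complex (T : finType) := nat -> {set {set T}}.

Definition graph_complex (T : finType) (e : rel T) : complex T :=
  fun d => match d with
  | 0%N => [set [set v] | v : T]
  | 1%N => [set [set p.1; p.2] | p : T * T & e p.1 p.2]
  | _ => finset.set0
  end.

Definition quad (n k : nat) (p : 'I_n * 'I_k) : {set 'I_n * 'I_k} :=
  [set p; (ordS p.1, p.2); (ordS p.1, ordS p.2); (p.1, ordS p.2)].

Definition torus_quadrangulation (n k : nat) : complex ('I_n * 'I_k)%type :=
  fun d => if d == 2%N then [set quad p | p : {: 'I_n * 'I_k}]
           else graph_complex (@torus_graph n k) d.

Definition automorphism (T : finType) (K : complex T) (s : {perm T}) : Prop :=
  forall d c, c \in K d -> exists e, s @: c \in K e.

(* Automorphisms of a simple graph, seen as a 1-complex, are its usual graph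
   automorphisms. *)
Lemma graph_automorphismP (T : finType) (e : rel T) (s : {perm T}) :
  symmetric e -> irreflexive e ->
  automorphism (graph_complex e) s <-> forall u v, e (s u) (s v) = e u v.
Proof.
move=> e_sym eirr; split=> [sK u v | se [|[|d]] c /=].
- have sub a b : e a b -> e (s a) (s b).
    move=> eab.
    have ab : s a != s b.
      by rewrite (inj_eq perm_inj); apply: contraL eab => /eqP->; rewrite eirr.
    have /(sK 1%N)[] : [set a; b] \in graph_complex e 1%N.
      by apply/imsetP; exists (a, b) => //=; rewrite inE.
    rewrite imsetU1 imset_set1 => -[|[|d]] /=; last by rewrite inE.
      case/imsetP=> x _ /setP E; move: (E (s a)) (E (s b)) ab.
      by rewrite !inE !eqxx orbT => /esym/eqP-> /esym/eqP->; rewrite eqxx.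
    case/imsetP=> -[x y] exy /setP E; rewrite inE /= in exy E.
    move: (E (s a)) (E (s b)) ab; rewrite !inE !eqxx orbT.
    move=> /esym/orP[]/eqP-> /esym/orP[]/eqP->; rewrite ?eqxx // => _.
    by rewrite e_sym.
  pose E := [set p : T * T | e p.1 p.2].
  pose f (p : T * T) := (s p.1, s p.2).
  have fI : injective f by move=> [a b] [c d] [/perm_inj-> /perm_inj->].
  have fE : f @: E = E.
    apply/eqP; rewrite eqEcard card_imset // leqnn andbT.
    apply/fintype.subsetP=> _ /imsetP[[a b] + ->]; rewrite !inE; exact: sub.
  by have := mem_imset E (u, v) fI; rewrite fE !inE.
- by case/imsetP=> v _ ->; exists 0%N; rewrite imset_set1; apply/imsetP; exists (s v).
- case/imsetP=> -[a b] ab ->; exists 1%N; rewrite imsetU1 imset_set1.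
  by apply/imsetP; exists (s a, s b) => //=; rewrite inE /= se; move: ab; rewrite inE.
- by rewrite inE.
Qed.

Local Open Scope ring_scope.
Local Open Scope classical_set_scope.

Section Euclidean.
Variables (R : realType) (N : nat).
Implicit Types (x y : 'rV[R]_N) (P F : set 'rV[R]_N).

Definition dotp x y : R := \sum_(i < N) x ord0 i * y ord0 i.

(* The library norm on row vectors is the sup norm, hence this definition. *)
Definition edist x y : R := Num.sqrt (dotp (x - y) (x - y)).

Definition isometry (f : 'rV[R]_N -> 'rV[R]_N) : Prop :=
  forall x y, edist (f x) (f y) = edist x y.

Definition hull (A : set 'rV[R]_N) : set 'rV[R]_N :=
  smallest (fun C : set 'rV[R]_N => convex_set C) A.

(* F has affine dimension d: its affine span is x + (row space of B) for some
   linearly independent rows of B. *)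
Definition affdim F (d : nat) : Prop :=
  exists (x : 'rV[R]_N) (B : 'M[R]_(d, N)),
    [/\ F x, row_free B, forall i, F (x + row i B)
      & forall y, F y -> (y - x <= B)%MS].

(* A nonempty proper face: the intersection of P with a supporting
   hyperplane. *)
Definition proper_face P F : Prop :=
  [/\ F !=set0, F <> P &
    exists (c : 'rV[R]_N) (b : R),
      (forall x, P x -> dotp c x <= b) /\ F = [set x | P x /\ dotp c x = b]].

(* The m-skeleton of the boundary complex of P, as a set of cells. *)
Definition boundary_skeleton P (m : nat) : set (set 'rV[R]_N) :=
  [set F | proper_face P F /\ exists2 d, (d <= m)%N & affdim F d].

Definition euclidean_symmetry (X : set (set 'rV[R]_N))
    (f : 'rV[R]_N -> 'rV[R]_N) : Prop :=
  isometry f /\ [set f @` F | F in X] = X.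

Section Realization.
Variables (T : finType) (K : complex T) (phi : T -> 'rV[R]_N).

Definition cell_hull (c : {set T}) : set 'rV[R]_N := hull (phi @` [set` c]).

Definition realization : set (set 'rV[R]_N) :=
  [set F | exists d, exists2 c, c \in K d & F = cell_hull c].

(* X is a polyhedron (a set of convex cells) realizing K with vertex map phi:
   the cells of X are the hulls of the cells of K, with the right dimensions,
   and they intersect exactly as prescribed by K. *)
Definition realizes (X : set (set 'rV[R]_N)) : Prop :=
  [/\ injective phi,
      X = realization,
      forall d c, c \in K d -> affdim (cell_hull c) d
    & forall d1 c1 d2 c2, c1 \in K d1 -> c2 \in K d2 ->
        cell_hull c1 `&` cell_hull c2 = cell_hull (c1 :&: c2)].

Definition without_hidden_symmetries (X : set (set 'rV[R]_N)) : Prop :=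
  forall s : {perm T}, automorphism K s ->
    exists2 f : 'rV[R]_N -> 'rV[R]_N,
      euclidean_symmetry X f & forall v, f (phi v) = phi (s v).

End Realization.
End Euclidean.

Definition duoprism_vertex (R : realType) (n k : nat) (p : 'I_n * 'I_k) :
    'rV[R]_4 :=
  let a := 2 * pi * p.1%:R / n%:R in
  let b := 2 * pi * p.2%:R / k%:R in
  \row_l [:: cos a; sin a; cos b; sin b]`_l.

Definition duoprism (R : realType) (n k : nat) : set 'rV[R]_4 :=
  hull (range (@duoprism_vertex R n k)).

Definition Qhat (R : realType) (n k : nat) : set (set 'rV[R]_4) :=
  realization (@torus_quadrangulation n k) (@duoprism_vertex R n k).

(* Main.v *)
Require Import Defs.
From mathcomp Require Import all_boot all_order all_algebra perm.
From mathcomp Require Import all_classical all_reals all_analysis.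
From mathcomp Require Import ring lra.

(** The proof has a metric and a combinatorial half.

    Faces. A linear form on the product of two polygons is the sum of a form on
    each factor, so the vertices where it is maximal form a product of two sets
    of maximizers. Every vertex and every edge of a regular polygon is the set of
    maximizers of some form ([seg_exposed]), hence every vertex, edge and
    quadrilateral of the quadrangulation is a face of the duoprism
    ([box_exposed]). This gives the realization properties: the intersection of
    two faces is the hull of their common vertices ([cell_hull_setI]), and three
    vertices of a quadrilateral are affinely independent because an edge is a
    face ([exposed_row_free]). Conversely, on a polygon a form whose maximum is
    attained twice is maximal along an edge ([argmax_edge]), so each face of
    the duoprism other than a vertex contains one of the edges, and there are no
    faces of dimension at most 1 besides these vertices and edges
    ([low_face_cell]).

    Symmetries. A permutation of a spanning family of vectors is induced by an
    orthogonal map as soon as it preserves inner products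
    ([gram_orthogonal]); here the inner product of the vertices [u] and [v] is
    [cos (2 pi (u.1 - v.1) / n) + cos (2 pi (u.2 - v.2) / k)] ([gramE]). An
    automorphism of the quadrangulation preserves the graph, because the number
    of vertices of a cell determines its dimension; so it remains to prove that
    each automorphism of the graph preserves these inner products
    ([graph_automorphism_gram]). Identify the vertices with Z/n x Z/k. Two
    perpendicular edges at a vertex span a square, so their endpoints have two
    common neighbours, while the endpoints of two collinear edges have only one,
    unless the cycle has length 4. It follows that, unless n = k = 4,
    perpendicularity is preserved ([graph_automorphism_perp]), which
    forces the automorphism to be an affine map of Z/n x Z/k with linear part a
    signed permutation of the two axes ([perp_preserving_affine]); exchanging
    the axes is possible only for n = k. Such maps visibly preserve the inner
    products. For n = k = 4 the inner product is 2 minus the graph distance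
    ([tesseract_gram]), which every automorphism preserves.

    In the lemmas the lengths are written [n.+3] and [k.+3]: then ['I_n.+3] is the
    ring Z/(n + 3), and the successor on the cycle is [+ 1]. *)

Set Implicit Arguments.
Unset Strict Implicit.
Unset Printing Implicit Defensive.

Import Order.TTheory GRing.Theory Num.Theory.
Local Open Scope ring_scope.
Local Open Scope classical_set_scope.

(** * Steps of the discrete torus *)

Lemma ordS_add1 m (i : 'I_m.+3) : ordS i = i + 1.
Proof. by apply: val_inj; rewrite /= addn1. Qed.

Definition seg m (b : bool) (i : 'I_m) : {set 'I_m} :=
  if b then [set i; ordS i]%SET else [set i]%SET.

Section Steps.
Variables n k : nat.
Local Notation V := ('I_n.+3 * 'I_k.+3)%type.
Implicit Types (a b c d u v w : V).

Definition unit_step m (x : 'I_m.+3) := (x == 1) || (x == -1).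
Definition horizontal a := unit_step a.1 && (a.2 == 0).
Definition vertical a := (a.1 == 0) && unit_step a.2.
Definition step a := horizontal a || vertical a.

(** Perpendicularity is reserved for steps along different axes: two distinct
    steps span a face of the quadrangulation exactly when they are
    perpendicular, and are opposite otherwise. *)
Definition perp a b := horizontal a && vertical b || vertical a && horizontal b.

Lemma unit_stepN m (x : 'I_m.+3) : unit_step (- x) = unit_step x.
Proof. by rewrite /unit_step !eqr_oppLR opprK orbC. Qed.

Lemma unit_step_double_neq0 m (x : 'I_m.+3) : unit_step x -> x + x != 0.
Proof. by case/orP => /eqP-> //; rewrite -opprD oppr_eq0. Qed.

Lemma unit_step_neq0 m (x : 'I_m.+3) : unit_step x -> x != 0.
Proof. by case/orP => /eqP-> //; rewrite oppr_eq0. Qed.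

Lemma unit_step_eq m (x y : 'I_m.+3) : unit_step x -> unit_step y ->
  y = x \/ y = - x.
Proof.
by move=> /orP[]/eqP-> /orP[]/eqP->; rewrite ?opprK; auto.
Qed.

Lemma horizontal_notvertical a : horizontal a -> vertical a = false.
Proof. by case/andP=> /unit_step_neq0/negPf a1 _; rewrite /vertical a1. Qed.

Lemma stepN a : step (- a) = step a.
Proof. by rewrite /step /horizontal /vertical /= !unit_stepN !oppr_eq0. Qed.

Lemma perpC a b : perp a b = perp b a.
Proof. by rewrite /perp orbC andbC [X in _ || X]andbC. Qed.

Lemma perpN a b : perp a (- b) = perp a b.
Proof. by rewrite /perp /horizontal /vertical /= !unit_stepN !oppr_eq0. Qed.

Lemma perp_step a b : perp a b -> step a.
Proof. by rewrite /step; case/orP=> /andP[-> _]; rewrite ?orbT. Qed.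

Lemma perp_irr a : perp a a = false.
Proof.
apply/negP; rewrite /perp => /orP[]/andP[]; first by move/horizontal_notvertical->.
by move=> + /horizontal_notvertical => ->.
Qed.

Lemma step_double_neq0 a : step a -> a + a != 0.
Proof.
rewrite -pair_eqE /= negb_and.
by case/orP=> /andP[] => [/unit_step_double_neq0-> | _ /unit_step_double_neq0->];
  rewrite ?orbT.
Qed.

Lemma step_neqN a : step a -> a != - a.
Proof. by move/step_double_neq0; rewrite addr_eq0. Qed.

Lemma step_neq0 a : step a -> a != 0.
Proof. by move/step_neqN; apply: contra_neq => ->; rewrite oppr0. Qed.

Lemma stepP a : step a -> (exists2 x, unit_step x & a = (x, 0)) \/
  (exists2 y, unit_step y & a = (0, y)).
Proof.
case: a => x y /orP[]/andP[/= x1 y1]; [left; exists x | right; exists y] => //.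
  by rewrite (eqP y1).
by rewrite (eqP x1).
Qed.

Lemma horizontal_step (x : 'I_n.+3) : unit_step x -> step ((x, 0) : V).
Proof. by move=> xP; rewrite /step /horizontal /= xP. Qed.

Lemma vertical_step (y : 'I_k.+3) : unit_step y -> step ((0, y) : V).
Proof. by move=> yP; rewrite /step /vertical /= yP orbT. Qed.

Lemma perpP a b : perp a b -> exists x y, [/\ unit_step x, unit_step y &
  a = (x, 0) /\ b = (0, y) \/ a = (0, y) /\ b = (x, 0)].
Proof.
case: a b => [a1 a2] [b1 b2] /orP[]/andP[]/andP[/= p q] /andP[/= r t].
  by exists a1, b2; rewrite (eqP q) (eqP r); split; auto.
by exists b1, a2; rewrite (eqP p) (eqP t); split; auto.
Qed.

Lemma step_parallel a b : step a -> step b -> ~~ perp a b -> b = a \/ b = - a.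
Proof.
move=> /stepP[] [x xP ->] /stepP[] [y yP ->];
  rewrite /perp /horizontal /vertical /= ?xP ?yP ?eqxx ?orbT //= => _.
  by case: (unit_step_eq xP yP) => ->; [left | right; congr pair; rewrite oppr0].
by case: (unit_step_eq xP yP) => ->; [left | right; congr pair; rewrite oppr0].
Qed.

Lemma perp_parallel a b c : perp a b -> perp a c -> c = b \/ c = - b.
Proof.
move=> /perpP[x [y [xP yP ab]]] /perpP[z [t [zP tP ac]]].
have x0 := negPf (unit_step_neq0 xP); have y0 := negPf (unit_step_neq0 yP).
case: ab ac => -[-> ->] [] [/pair_eqP/andP[/= /eqP E1 /eqP E2] ->].
- by case: (unit_step_eq yP tP) => ->; [left | right; congr pair; rewrite oppr0].
- by rewrite E1 eqxx in x0.
- by rewrite E2 eqxx in y0.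
- by case: (unit_step_eq xP zP) => ->; [left | right; congr pair; rewrite oppr0].
Qed.

(** The endpoints [u + a] and [u + b] of two perpendicular steps have only two
    common neighbours, [u] and the fourth corner of the square: comparing
    coordinates in [a + c = b + d] leaves no other choice of [c]. *)
Lemma perp_square a b c d : perp a b -> step c -> step d -> a + c = b + d ->
  c = b \/ c = - a.
Proof.
move=> /perpP[x [y [xP yP ab]]].
have x0 := unit_step_neq0 xP; have y0 := unit_step_neq0 yP.
case: ab => -[-> ->] /stepP[] [z zP ->] /stepP[] [t tP ->] /pair_eqP/andP[/=];
  rewrite ?addr0 ?add0r; do ?[by rewrite ?[0 == _]eq_sym ?(negPf x0) ?(negPf y0)].
- by rewrite addrC addr_eq0 => /eqP-> _; right; congr pair; rewrite oppr0.
- by move=> _ /eqP->; left.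
- by move=> /eqP-> _; left.
- by rewrite [y + z]addrC addr_eq0 => _ /eqP->; right; congr pair; rewrite oppr0.
Qed.

(** In contrast, [u + a] and [u - a] have [u] as their only common neighbour,
    unless the cycle along [a] has length 4: a second one would need
    [2 a = d - c] with [c] and [d] steps along the same cycle, hence
    [2 a = - 2 a]. *)
Lemma straight_step a c d : step a -> a + a + (a + a) != 0 ->
  step c -> step d -> a + c = - a + d -> c = - a.
Proof.
have pm m (x z t : 'I_m.+3) : unit_step x -> unit_step z -> unit_step t ->
    x + x + (x + x) != 0 -> x + z = - x + t -> z = - x.
  move=> xP zP tP; case: (unit_step_eq xP zP) => -> //.
  have x2 := unit_step_double_neq0 xP.
  case: (unit_step_eq xP tP) => -> x4 /eqP.
    by rewrite [- x + x]addrC subrr (negPf x2).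
  by rewrite -subr_eq0 opprD opprK (negPf x4).
have N0 m (x : 'I_m.+3) : unit_step x -> x != - x.
  by move/unit_step_double_neq0; rewrite addr_eq0.
case/stepP=> -[x xP ->]; rewrite -pair_eqE /= ?addr0 ?eqxx ?andbT => x4;
  case/stepP=> -[z zP ->]; case/stepP=> -[t tP ->] /pair_eqP/andP[/=];
  rewrite ?addr0 ?add0r ?oppr0 ?add0r.
- by move=> /eqP xzt _; congr pair; [apply: pm x4 xzt | rewrite oppr0].
- by rewrite [0 == t]eq_sym (negPf (unit_step_neq0 tP)).
- by rewrite (negPf (unit_step_neq0 zP)).
- by rewrite (negPf (N0 _ _ xP)).
- by rewrite (negPf (N0 _ _ xP)).
- by rewrite (negPf (unit_step_neq0 zP)).
- by rewrite [0 == t]eq_sym (negPf (unit_step_neq0 tP)).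
- by move=> _ /eqP xzt; congr pair; [rewrite oppr0 | apply: pm x4 xzt].
Qed.

Definition e1 : V := (1, 0).
Definition e2 : V := (0, 1).

Lemma perp_exists a : step a -> exists b, perp a b.
Proof.
by case/stepP=> -[x xP ->]; [exists e2 | exists e1];
  rewrite /perp /horizontal /vertical /= xP ?orbT.
Qed.

Section StepMaps.
Variable s : V -> V.
Hypothesis s_inj : injective s.
Hypothesis s_step : forall u a, step a -> step (s (u + a) - s u).

Lemma delta_eq u a b : s (u + a) - s u = s (u + b) - s u -> a = b.
Proof. by move/addIr/s_inj/addrI. Qed.

(** A step map that keeps perpendicular steps perpendicular is affine. The
    increments at a vertex [u] of the steps [d] and [- d] are both
    perpendicular to the increment of a step across [d], so they are opposite;
    hence the increment of [d] does not change along [d]. It does not change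
    across [d] either, since the image of a square closes up by
    [perp_square]. Natural multiples keep the statement meaningful before it is
    known that the increments have the right orders. *)
Lemma perp_preserving_affine :
    (forall u a b, perp a b -> perp (s (u + a) - s u) (s (u + b) - s u)) ->
  exists2 ab, perp ab.1 ab.2 & forall i j : nat,
    s (e1 *+ i + e2 *+ j) = s 0 + (ab.1 *+ i + ab.2 *+ j).
Proof.
move=> s_perp; pose delta u a := s (u + a) - s u.
have tele x y z : (y - x) + (z - y) = z - x :> V by rewrite addrC addrA subrK.
have opp u a : step a -> delta u (- a) = - delta u a.
  move=> aP; have [b ab] := perp_exists aP.
  have ba : perp b a by rewrite perpC.
  have bNa : perp b (- a) by rewrite perpN.
  case: (perp_parallel (s_perp u _ _ ba) (s_perp u _ _ bNa)) => //.
  by move/delta_eq/esym/eqP; rewrite (negPf (step_neqN aP)).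
(* The step back from [u + a] is the opposite of the step onward. *)
have along u a : step a -> delta (u + a) a = delta u a.
  move=> aP; rewrite -[LHS]opprK -opp // /delta addrK opprB //.
have across u a b : perp a b -> delta (u + b) a = delta u a.
  move=> ab; have ba : perp b a by rewrite perpC.
  have [aP bP] := (perp_step ab, perp_step ba).
  have E : delta u a + delta (u + a) b = delta u b + delta (u + b) a.
    by rewrite /delta !tele [u + a + b]addrAC.
  have [cP dP] : step (delta (u + a) b) /\ step (delta (u + b) a).
    by split; apply: s_step.
  case: (perp_square (s_perp u a b ab) cP dP E) => [c|c].
    by move: E; rewrite c addrC => /addrI.
  move: c; rewrite /delta opprB => /addIr/s_inj/eqP.
  rewrite -addrA -subr_eq0 addrAC subrr add0r addr_eq0 => /eqP abN.
  by move: ab; rewrite abN perpC perpN perp_irr.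
have [ab perp_ab] : exists ab, ab = (delta 0 e1, delta 0 e2) by eexists.
exists ab; first by rewrite perp_ab; apply: s_perp.
have e12 : perp e1 e2 by []; have e21 : perp e2 e1 by rewrite perpC.
have [e1P e2P] := (perp_step e12, perp_step e21).
have delta1 i j : delta (e1 *+ i + e2 *+ j) e1 = delta 0 e1.
  elim: j => [|j IH]; last by rewrite mulrSr addrA across.
  elim: i => [|i IH]; first by rewrite !mulr0n addr0.
  by rewrite mulrSr addrAC along.
have delta2 i j : delta (e1 *+ i + e2 *+ j) e2 = delta 0 e2.
  elim: j => [|j IH]; last by rewrite mulrSr addrA along.
  elim: i => [|i IH]; first by rewrite !mulr0n addr0.
  by rewrite mulrSr addrAC across.
move=> i; elim=> [|j IH].
  elim: i => [|i IH]; first by rewrite !mulr0n !addr0.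
  move: IH; rewrite !mulr0n !addr0 => IH; have := delta1 i 0.
  rewrite mulr0n addr0 {1}/delta => /(canRL (subrK _)).
  by rewrite -mulrSr => ->; rewrite IH perp_ab /= mulrS addrCA.
have := delta2 i j; rewrite {1}/delta => /(canRL (subrK _)).
rewrite -addrA -mulrSr => ->; rewrite IH perp_ab /= mulrS addrCA.
by rewrite [delta _ _ + (_ + _)]addrCA.
Qed.
End StepMaps.
End Steps.

(** * Cells and automorphisms of the toroidal quadrangulation *)

Section Automorphisms.
Variables n k : nat.
Local Notation V := ('I_n.+3 * 'I_k.+3)%type.
Local Notation torus := (@torus_graph n.+3 k.+3).
Implicit Types (u v w p : V) (c : {set V}) (s : {perm V}).

Lemma cycle_adjE m (x y : 'I_m.+3) : cycle_adj x y = unit_step (y - x).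
Proof.
rewrite /cycle_adj /unit_step !ordS_add1 !subr_eq [1 + x]addrC; congr (_ || _).
by apply/eqP/eqP=> ->; rewrite addrC ?addrK ?addrA ?subrK ?subrr ?add0r.
Qed.

Lemma torus_graphE u v : torus u v = step (v - u).
Proof.
rewrite /torus_graph /cart_prod /step /horizontal /vertical /= !cycle_adjE.
by rewrite !subr_eq0 orbC andbC ![v.1 == _]eq_sym ![v.2 == _]eq_sym.
Qed.

Lemma torus_sym : symmetric torus.
Proof. by move=> u v; rewrite !torus_graphE -opprB stepN. Qed.

Lemma torus_irr : irreflexive torus.
Proof.
move=> u; rewrite torus_graphE subrr; apply/negP=> /step_neq0.
by rewrite eqxx.
Qed.

(** All the cells of the quadrangulation at once: products of two vertices, of
    a vertex and an edge, or of two edges. *)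
Definition box (b1 b2 : bool) p : {set V} := finset.setX (seg b1 p.1) (seg b2 p.2).

Lemma card_seg m (b : bool) (i : 'I_m.+3) : #|seg b i| = (2 ^ b)%N.
Proof.
rewrite /seg; case: b; last by rewrite cards1.
rewrite cards2 ordS_add1 -[X in X != _]addr0 (inj_eq (addrI _)).
by [].
Qed.

Lemma in_seg m (b : bool) (i x : 'I_m) :
  (x \in seg b i) = (x == i) || b && (x == ordS i).
Proof. by case: b; rewrite !inE ?orbF. Qed.

Lemma in_box (b1 b2 : bool) p q :
  (q \in box b1 b2 p) = (q.1 \in seg b1 p.1) && (q.2 \in seg b2 p.2).
Proof. by case: q => i j; rewrite finset.in_setX. Qed.

Lemma card_box (b1 b2 : bool) p : #|box b1 b2 p| = (2 ^ (b1 + b2))%N.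
Proof. by rewrite cardsX !card_seg expnD. Qed.

Lemma vertex_eqE u v : (u == v) = (u.1 == v.1) && (u.2 == v.2).
Proof. by []. Qed.

Lemma box_vertex p : box false false p = [set p]%SET.
Proof. by apply/setP=> q; rewrite in_box !in_seg !inE vertex_eqE /= !orbF. Qed.

Lemma box_horizontal p : box true false p = [set p; (ordS p.1, p.2)]%SET.
Proof.
by apply/setP=> q; rewrite in_box !in_seg !inE !vertex_eqE /= !orbF andb_orl.
Qed.

Lemma box_vertical p : box false true p = [set p; (p.1, ordS p.2)]%SET.
Proof.
by apply/setP=> q; rewrite in_box !in_seg !inE !vertex_eqE /= !orbF andb_orr.
Qed.

Lemma quadE p : quad p = box true true p.
Proof.
apply/setP=> q; rewrite in_box !in_seg !inE !vertex_eqE /=.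
by case: (q.1 == p.1); case: (q.1 == ordS p.1); case: (q.2 == p.2);
  case: (q.2 == ordS p.2).
Qed.

Lemma cellP d c : c \in @torus_quadrangulation n.+3 k.+3 d <->
  exists b1 b2 p, c = box b1 b2 p /\ d = (b1 + b2)%N.
Proof.
split.
  case: d => [|[|[|d]]] /=.
  - by case/imsetP=> p _ ->; exists false, false, p; rewrite box_vertex.
  - case/imsetP=> -[u v]; rewrite inE /= => + ->.
    move/orP=> []/andP[/eqP E /orP[]/eqP F].
    + by exists false, true, u; rewrite box_vertical -F E -surjective_pairing.
    + exists false, true, v.
      by rewrite box_vertical -F -E -surjective_pairing finset.setUC.
    + by exists true, false, u; rewrite box_horizontal -F E -surjective_pairing.
    + exists true, false, v.
      by rewrite box_horizontal -F -E -surjective_pairing finset.setUC.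
  - by case/imsetP=> p _ ->; exists true, true, p; rewrite quadE.
  - by rewrite inE.
move=> [b1 [b2 [p [-> ->]]]]; case: b1 b2 => [] [] /=.
- by rewrite -quadE; apply: imset_f.
- rewrite box_horizontal; apply/imsetP; exists (p, (ordS p.1, p.2)) => //.
  by rewrite inE /torus_graph /cart_prod /cycle_adj /= !eqxx orbT.
- rewrite box_vertical; apply/imsetP; exists (p, (p.1, ordS p.2)) => //.
  by rewrite inE /torus_graph /cart_prod /cycle_adj /= !eqxx.
- by rewrite box_vertex; apply: imset_f.
Qed.

Lemma graph_cellP d c : c \in graph_complex torus d <->
  (d <= 1)%N /\ c \in @torus_quadrangulation n.+3 k.+3 d.
Proof. by case: d => [|[|[|d]]] /=; rewrite ?inE; split=> // -[]. Qed.

(** The cardinal [2 ^ d] of a cell determines its dimension, so an automorphism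
    preserves dimensions although this is not part of its definition. *)
Lemma quad_automorphism_cell s d c :
  automorphism (@torus_quadrangulation n.+3 k.+3) s ->
  c \in @torus_quadrangulation n.+3 k.+3 d ->
  s @: c \in @torus_quadrangulation n.+3 k.+3 d.
Proof.
move=> sK cK; have [e ce] := sK d c cK; suff -> : d = e by [].
have cardE d' c' : c' \in @torus_quadrangulation n.+3 k.+3 d' -> #|c'| = (2 ^ d')%N.
  by case/cellP=> [b1 [b2 [p [-> ->]]]]; rewrite card_box.
have := cardE _ _ ce; rewrite card_imset ?(cardE _ _ cK) //; last exact: perm_inj.
by move/eqP; rewrite eqn_exp2l // => /eqP.
Qed.

Lemma quad_automorphism_graph s :
  automorphism (@torus_quadrangulation n.+3 k.+3) s ->
  automorphism (graph_complex torus) s.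
Proof.
move=> sK d c /graph_cellP[d1 cd]; exists d; apply/graph_cellP; split=> //.
exact: quad_automorphism_cell.
Qed.

Section GraphAutomorphisms.
Variable s : {perm V}.
Hypothesis s_adj : forall u v, torus (s u) (s v) = torus u v.

Lemma graph_automorphism_step u a : step a -> step (s (u + a) - s u).
Proof.
by move=> aP; rewrite -torus_graphE s_adj torus_graphE addrAC subrr add0r.
Qed.

(** Counting common neighbours distinguishes perpendicular steps from opposite
    ones, by [perp_square] and [straight_step], except along a cycle of
    length 4. If [a] and [b] are perpendicular at [u] and their images are
    opposite, then so are the images of [- a] and [- b], which occupy the other
    axis; hence both cycles have length 4. *)
Lemma graph_automorphism_perp :
    (n, k) != (1%N, 1%N) ->
  forall u a b, perp a b -> perp (s (u + a) - s u) (s (u + b) - s u).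
Proof.
move=> nk u a b ab; pose delta u a := s (u + a) - s u.
have inj (u' a' b' : V) : a' != b' -> delta u' a' != delta u' b'.
  by apply: contra_neq; exact: (delta_eq (@perm_inj _ s)).
(* A bad corner can only occur along a cycle of length 4. *)
have short (u' a' b' : V) : perp a' b' -> ~~ perp (delta u' a') (delta u' b') ->
    delta u' a' + delta u' a' + (delta u' a' + delta u' a') = 0.
  move=> ab' nab; have ba' : perp b' a' by rewrite perpC.
  have [aP bP] := (perp_step ab', perp_step ba').
  have daP := graph_automorphism_step u' aP.
  have dbP := graph_automorphism_step u' bP.
  have dN : delta u' b' = - delta u' a'.
    case: (step_parallel daP dbP nab) => // /(delta_eq (@perm_inj _ s)) abE.
    by rewrite abE perp_irr in ab'.
  apply/eqP/negPn/negP => d4.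
  have cP : step (delta (u' + a') b') by exact: graph_automorphism_step.
  have dP : step (delta (u' + b') a') by exact: graph_automorphism_step.
  have tele (x y z : V) : (y - x) + (z - y) = z - x by rewrite addrC addrA subrK.
  have E : delta u' a' + delta (u' + a') b' = - delta u' a' + delta (u' + b') a'.
    by rewrite -dN /delta !tele [u' + a' + b']addrAC.
  move: (straight_step daP d4 cP dP E); rewrite /delta opprB => /addIr/perm_inj/eqP.
  rewrite -addrA -subr_eq0 addrAC subrr add0r addr_eq0 => /eqP abN.
  by move: ab'; rewrite abN perpC perpN perp_irr.
have ba : perp b a by rewrite perpC.
have [aP bP] := (perp_step ab, perp_step ba).
have NP (d : V) : step d -> step (- d) by rewrite stepN.
have sP (d : V) : step d -> step (delta u d) by exact: graph_automorphism_step.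
apply/negPn/negP => nab.
have dN : delta u b = - delta u a.
  case: (step_parallel (sP _ aP) (sP _ bP) nab) => // /(delta_eq (@perm_inj _ s)) abE.
  by rewrite abE perp_irr in ab.
have aNa := step_neqN aP; have bNb := step_neqN bP.
have abN : a != - b by apply: contraTneq ab => ->; rewrite perpC perpN perp_irr.
have baN : b != - a by apply: contraTneq ba => ->; rewrite perpC perpN perp_irr.
(* The images of [a] and [b] fill one axis, so those of [- a] and [- b] lie on
   the other one. *)
have aa' : perp (delta u a) (delta u (- a)).
  apply/negPn/negP => /(step_parallel (sP _ aP) (sP _ (NP _ aP))) [].
    by apply/eqP; rewrite eq_sym inj.
  by rewrite -dN; apply/eqP; rewrite eq_sym inj.
have ab' : perp (delta u a) (delta u (- b)).
  apply/negPn/negP => /(step_parallel (sP _ aP) (sP _ (NP _ bP))) [].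
    by apply/eqP; rewrite eq_sym inj.
  by rewrite -dN; apply/eqP; rewrite eq_sym inj.
have naNb : ~~ perp (delta u (- a)) (delta u (- b)).
  by case: (perp_parallel aa' ab') => ->; rewrite ?perpN perp_irr.
have abNN : perp (- a) (- b) by rewrite perpN perpC perpN perpC.
have a4 := short _ _ _ ab nab; have a4' := short _ _ _ abNN naNb.
have four m (x : 'I_m.+3) : unit_step x -> x + x + (x + x) = 0 -> m = 1%N.
  move=> xP x4; have : (4%:R : 'I_m.+3) == 0.
    case/orP: xP x4 => /eqP-> x4; first by rewrite -x4; apply/eqP; ring.
    by rewrite -oppr_eq0 -x4; apply/eqP; ring.
  by case: m {x xP x4} => [|[|m]] //.
case/perpP: aa' => x [y [xP yP xy]].
have [n1 k1] : n = 1%N /\ k = 1%N.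
  case: xy => -[E1 E2]; move: a4 a4'; rewrite E1 E2 => /pair_eqP/andP[/= p1 p2];
    move=> /pair_eqP/andP[/= q1 q2].
    by split; [apply: four xP (eqP p1) | apply: four yP (eqP q2)].
  by split; [apply: four xP (eqP q1) | apply: four yP (eqP p2)].
by rewrite n1 k1 eqxx in nk.
Qed.

End GraphAutomorphisms.

End Automorphisms.

(** * The graph distance of the tesseract *)

Section Hypercube.
Local Notation V := ('I_4 * 'I_4)%type.
Implicit Types (u v w a : V).

Definition cycle4_dist (x : 'I_4) : nat := nth 0%N [:: 0; 1; 2; 1]%N x.
(** Characterized by [torus4_dist_step] and [torus4_dist_descent] as the graph
    distance from the origin. *)
Definition torus4_dist u := (cycle4_dist u.1 + cycle4_dist u.2)%N.

Lemma torus4_dist_step u a : step a ->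
  (torus4_dist (u + a)%R <= torus4_dist u + 1)%N.
Proof.
have H (x z : 'I_4) : unit_step z -> (cycle4_dist (x + z)%R <= cycle4_dist x + 1)%N.
  by case/orP=> /eqP->; case: x => [[|[|[|[|x]]]] ?].
case: u => x y /stepP[] [z zP ->]; rewrite /torus4_dist /= addr0.
  by rewrite addnAC leq_add2r H.
by rewrite -addnA leq_add2l H.
Qed.

Lemma torus4_dist_descent u : u != 0 ->
  exists2 a, step a & (torus4_dist (u + a)%R < torus4_dist u)%N.
Proof.
have H (x : 'I_4) : x != 0 ->
    exists2 z, unit_step z & (cycle4_dist (x + z)%R < cycle4_dist x)%N.
  by case: x => [[|[|[|[|x]]]] ?] //= _; [exists (-1)|exists 1|exists 1].
case: u => x y; have [->|x0] := eqVneq x 0 => [|_].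
  rewrite -pair_eqE /= => /H[z zP lt]; exists (0, z).
    exact: vertical_step.
  by rewrite /torus4_dist /= ltn_add2l.
have [z zP lt] := H x x0; exists (z, 0).
  exact: horizontal_step.
by rewrite /torus4_dist /= addr0 ltn_add2r.
Qed.

(** A geodesic is mapped to a walk of the same length: descend from [u] to [v]
    one step at a time. *)
Lemma torus4_dist_nonexpansive (s : V -> V) :
    (forall u a, step a -> step (s (u + a) - s u)) ->
  forall u v, (torus4_dist (s u - s v)%R <= torus4_dist (u - v)%R)%N.
Proof.
move=> s_step u v; move: {2}_.+1 (ltnSn (torus4_dist (u - v)%R)) => d.
elim: d u => // d IH u; rewrite ltnS => le_d.
have [->|] := eqVneq u v; first by rewrite !subrr.
rewrite -subr_eq0 => /torus4_dist_descent[a aP]; rewrite addrAC => lt_d.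
have := IH (u + a) (leq_trans lt_d le_d) => le_s.
have -> : s u - s v = (s (u + a) - s v) + - (s (u + a) - s u).
  by rewrite opprB [RHS]addrC addrA subrK.
apply: leq_trans (torus4_dist_step _ _) _; first by rewrite stepN s_step.
by rewrite addn1; apply: leq_ltn_trans le_s lt_d.
Qed.

Lemma torus4_dist_automorphism (s : {perm V}) :
    (forall u v, torus_graph (s u) (s v) = torus_graph u v) ->
  forall u v, torus4_dist (s u - s v)%R = torus4_dist (u - v)%R.
Proof.
move=> s_adj u v; apply/eqP; rewrite eqn_leq; apply/andP; split.
  by apply: torus4_dist_nonexpansive => *; apply: graph_automorphism_step.
have sV_adj u' v' : torus_graph ((s^-1)%g u') ((s^-1)%g v') = torus_graph u' v'.
  by rewrite -s_adj !permKV.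
have := @torus4_dist_nonexpansive (s^-1)%g _ (s u) (s v); rewrite !permK; apply.
by move=> *; apply: graph_automorphism_step.
Qed.

End Hypercube.

(** * Convex hulls of finite families *)

Section Dotp.
Variables (R : realType) (N : nat).
Implicit Types x y c : 'rV[R]_N.

Lemma dotpE x y : dotp x y = (x *m y^T) 0 0.
Proof. by rewrite mxE; apply: eq_bigr => i _; rewrite mxE. Qed.

Lemma dotpDr c x y : dotp c (x + y) = dotp c x + dotp c y.
Proof. by rewrite !dotpE linearD mulmxDr mxE. Qed.

Lemma dotpBr c x y : dotp c (x - y) = dotp c x - dotp c y.
Proof. by rewrite !dotpE linearB mulmxBr !mxE. Qed.

Lemma dotpZr c a x : dotp c (a *: x) = a * dotp c x.
Proof. by rewrite !dotpE linearZ -scalemxAr mxE. Qed.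

Lemma dotp_sumr (I : finType) c (w : I -> R) (F : I -> 'rV[R]_N) :
  dotp c (\sum_i w i *: F i) = \sum_i w i * dotp c (F i).
Proof.
rewrite dotpE linear_sum mulmx_sumr summxE; apply: eq_bigr => i _.
by rewrite linearZ -scalemxAr mxE dotpE.
Qed.

End Dotp.

Section Hull.
Variables (R : realType) (N : nat).
Implicit Types (A C : set 'rV[R]_N).

Lemma convex_setP A :
  convex_set (A : set (convex_lmodType 'rV[R]_N)) <->
  forall x y (t : R), A x -> A y -> 0 <= t <= 1 -> A (t *: x + (1 - t) *: y).
Proof.
split=> [cA x y t Ax Ay /andP[t0 t1] | cA x y t /set_mem Ax /set_mem Ay].
  by have := cA x y (Itv01 t0 t1) (mem_set Ax) (mem_set Ay) => /set_mem.
by apply/mem_set/cA => //; rewrite ge0 le1.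
Qed.

Lemma convex_hull A : convex_set (hull A : set (convex_lmodType 'rV[R]_N)).
Proof.
apply/convex_setP => x y t hx hy t01 C [cC AC].
by move/convex_setP: (cC); apply => //; [apply: hx | apply: hy].
Qed.

Lemma sub_hull A : A `<=` hull A.
Proof. exact: sub_gen_smallest. Qed.

Lemma hull_sub A C :
  convex_set (C : set (convex_lmodType 'rV[R]_N)) -> A `<=` C -> hull A `<=` C.
Proof. exact: smallest_sub. Qed.

Section Family.
Variables (T : finType) (M : T -> 'rV[R]_N).
Implicit Types (c : {set T}) (w : T -> R).

(** Stated with an explicit normalisation, so that an induction on the support
    of the weights is possible. *)
Lemma convex_combination_mem C w (r : seq T) :
    convex_set (C : set (convex_lmodType 'rV[R]_N)) ->
    (forall v, 0 <= w v) -> (forall v, w v != 0 -> C (M v)) ->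
    0 < \sum_(v <- r) w v ->
  C ((\sum_(v <- r) w v)^-1 *: \sum_(v <- r) w v *: M v).
Proof.
move=> /convex_setP cC w0 wC; elim: r => [|v r IH]; first by rewrite big_nil ltxx.
rewrite !big_cons; set S := \sum_(_ <- r) _; set X := \sum_(_ <- r) _ => S_gt0.
have S0 : 0 <= S by apply: sumr_ge0.
have [wv0|wv0] := eqVneq (w v) 0.
  by rewrite wv0 scale0r !add0r; apply: IH; rewrite wv0 add0r in S_gt0.
have [SE|SN0] := eqVneq S 0.
  have -> : X = 0.
    rewrite /X big_seq big1 // => u ur.
    move/eqP: SE; rewrite psumr_eq0 // => /allP /(_ u ur) /= /eqP ->.
    by rewrite scale0r.
  by rewrite SE !addr0 scalerA mulVf // scale1r; apply: wC.
have SP : 0 < S by rewrite lt_def SN0.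
have tot : w v + S != 0 by rewrite gt_eqF.
have := cC (M v) (S^-1 *: X) (w v / (w v + S)) (wC v wv0) (IH SP) _.
rewrite ler_pdivrMr // mul1r lerDl S0 divr_ge0 ?(ltW S_gt0) // => /(_ isT).
rewrite scalerDr !scalerA mulrC.
congr (C (_ + _ *: _)).
by field; rewrite SN0 tot.
Qed.

Lemma cell_hullP c x :
  cell_hull M c x <-> exists w, [/\ forall v, 0 <= w v,
    forall v, v \notin c -> w v = 0, \sum_v w v = 1 & x = \sum_v w v *: M v].
Proof.
split=> [|[w [w0 wc w1 ->]]]; last first.
  have := @convex_combination_mem _ w (index_enum T) (@convex_hull _) w0.
  rewrite w1 invr1 scale1r; apply; rewrite ?ltr01 // => v wv.
  apply: sub_hull; exists v => //=.
  by apply: contraNT wv => /wc ->.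
move: x; pose W := [set x | exists w, [/\ forall v, 0 <= w v,
    forall v, v \notin c -> w v = 0, \sum_v w v = 1 & x = \sum_v w v *: M v]].
apply: (@hull_sub _ W) => [|_ [v /= vc <-]].
  apply/convex_setP => _ _ t [w [w0 wc w1 ->]] [z [z0 zc z1 ->]] /andP[t0 t1].
  exists (fun v => t * w v + (1 - t) * z v); split.
  - by move=> v; rewrite addr_ge0 ?mulr_ge0 // subr_ge0.
  - by move=> v vc; rewrite wc ?zc // !mulr0 addr0.
  - by rewrite big_split /= -!mulr_sumr w1 z1; ring.
  - rewrite !scaler_sumr -big_split; apply: eq_bigr => v _ /=.
    by rewrite !scalerA -scalerDl.
exists (fun u => (u == v)%:R); split.
- by move=> u; rewrite ler0n.
- by move=> u uc; case: eqP => // uv; rewrite uv vc in uc.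
- by rewrite (bigD1 v) //= eqxx big1 ?addr0 // => u /negPf ->.
- rewrite (bigD1 v) //= eqxx scale1r big1 ?addr0 // => u /negPf ->.
  by rewrite scale0r.
Qed.

Lemma cell_hull_vertex c v : v \in c -> cell_hull M c (M v).
Proof. by move=> vc; apply: sub_hull; exists v. Qed.

Lemma cell_hullS c c' : c \subset c' -> cell_hull M c `<=` cell_hull M c'.
Proof.
move=> /fintype.subsetP cc'; apply: hull_sub; first exact: convex_hull.
by move=> _ [v /= vc <-]; apply: cell_hull_vertex; apply: cc'.
Qed.

Lemma cell_hull_image (A : 'M[R]_N) (s : T -> T) c :
    (forall v, M v *m A = M (s v)) ->
  [set x *m A | x in cell_hull M c] = cell_hull M (s @: c).
Proof.
move=> MA; apply/seteqP; split=> [_ [x cx <-]|].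
  move: x cx; pose C := [set x | cell_hull M (s @: c) (x *m A)].
  apply: (@hull_sub _ C) => [|_ [v /= vc <-]].
    apply/convex_setP => x y t Cx Cy t01; rewrite /C /= mulmxDl -!scalemxAl.
    by have /convex_setP := @convex_hull (M @` [set` s @: c]); apply.
  by rewrite /C /= MA; apply: cell_hull_vertex; apply: imset_f.
apply: hull_sub => [|_ [_ /imsetP[v vc ->] <-]]; last first.
  by exists (M v); [apply: cell_hull_vertex | apply: MA].
apply/convex_setP => _ _ t [x hx <-] [y hy <-] t01.
exists (t *: x + (1 - t) *: y); last by rewrite mulmxDl !scalemxAl.
by have /convex_setP := @convex_hull (M @` [set` c]); apply.
Qed.

Lemma dotp_cell_hull c a b : (forall v, v \in c -> dotp a (M v) <= b) ->
  forall x, cell_hull M c x -> dotp a x <= b.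
Proof.
move=> ab x /cell_hullP[w [w0 wc w1 ->]].
rewrite dotp_sumr -[leRHS]mul1r -w1 mulr_suml; apply: ler_sum => v _.
by have [/ab/ler_wpM2l->//|/wc ->] := boolP (v \in c); rewrite !mul0r.
Qed.

(** A convex combination reaches the maximum [b] of a linear form only if every
    point with a nonzero weight does. *)
Lemma cell_hull_face c a b : (forall v, v \in c -> dotp a (M v) <= b) ->
  cell_hull M c `&` [set x | dotp a x = b]
  = cell_hull M [set v in c | dotp a (M v) == b].
Proof.
move=> ab; apply/seteqP; split=> x.
  case=> /cell_hullP[w [w0 wc w1 ->]] /=; rewrite dotp_sumr => wb.
  apply/cell_hullP; exists w; split=> // v; rewrite inE negb_and.
  have [vc /= vb|/wc-> //] := boolP (v \in c).
  have : \sum_v w v * (b - dotp a (M v)) == 0.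
    under eq_bigr do rewrite mulrBr.
    by rewrite sumrB -mulr_suml w1 wb mul1r subrr.
  rewrite psumr_eq0 => [/allP/(_ v)|u _]; last first.
    by have [/ab ?|/wc ->] := boolP (u \in c); rewrite ?mul0r ?mulr_ge0 ?subr_ge0.
  rewrite mem_index_enum mulf_eq0 subr_eq0 [b == _]eq_sym (negPf vb) orbF.
  by move=> /(_ isT)/eqP.
case/cell_hullP=> w [w0 wc w1 ->]; split.
  apply/cell_hullP; exists w; split=> // v vc; apply: wc.
  by rewrite inE (negPf vc).
rewrite /= dotp_sumr -[RHS]mul1r -w1 mulr_suml; apply: eq_bigr => v _.
have [|/wc->] := boolP (v \in [set v in c | dotp a (M v) == b]%SET).
  by rewrite inE => /andP[_ /eqP->].
by rewrite !mul0r.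
Qed.

Lemma cell_hull_hyperplane c a b : (forall v, v \in c -> dotp a (M v) = b) ->
  forall x, cell_hull M c x -> dotp a x = b.
Proof.
move=> ab x cx; have le_b v : v \in c -> dotp a (M v) <= b by move/ab->.
suff [] : (cell_hull M c `&` [set x | dotp a x = b]) x by [].
rewrite (cell_hull_face le_b); apply: cell_hullS cx.
by apply/fintype.subsetP => v vc; rewrite inE vc ab /=.
Qed.

End Family.
End Hull.

(** * Linear forms on the vertices of a regular polygon *)

Section Circle.
Variables (R : realType) (n : nat).
Local Notation N := n.+3.
Local Notation I := 'I_n.+3.
Implicit Types (x y i j m : I).

Definition angle (d : nat) : R := 2 * pi * d%:R / N%:R.
Definition half_angle (d : nat) : R := pi * d%:R / N%:R.

Local Notation cs x := (cos (angle (nat_of_ord (x : I)))).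
Local Notation sn x := (sin (angle (nat_of_ord (x : I)))).
Local Notation h := (half_angle 1).

Lemma angleE d : angle d = half_angle d + half_angle d.
Proof. by rewrite /angle /half_angle -mulrDl; congr (_ / _); ring. Qed.

Lemma angleD d e : angle (d + e) = angle d + angle e.
Proof. by rewrite /angle natrD mulrDr mulrDl. Qed.

Lemma half_angleS d : half_angle d.+1 = half_angle d + h.
Proof. by rewrite /half_angle -addn1 natrD mulrDr mulrDl. Qed.

Lemma angle_mod d : exists q, angle d = angle (d %% N) + (pi *+ 2) *+ q.
Proof.
exists (d %/ N)%N; rewrite {1}(divn_eq d N) addnC angleD; congr (_ + _).
by rewrite /angle natrM mulrA mulfK ?pnatr_eq0 // -[RHS]mulr_natr mulr_natl.
Qed.

Lemma cos_angle_mod d : cos (angle (d %% N)) = cos (angle d).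
Proof. by have [q ->] := angle_mod d; rewrite (periodicn (@cosD2pi R)). Qed.

Lemma sin_angle_mod d : sin (angle (d %% N)) = sin (angle d).
Proof. by have [q ->] := angle_mod d; rewrite (periodicn (@sinD2pi R)). Qed.

Lemma cos_angleD x y : cs (x + y) = cs x * cs y - sn x * sn y.
Proof. by rewrite /= cos_angle_mod angleD cosD. Qed.

Lemma sin_angleD x y : sn (x + y) = sn x * cs y + cs x * sn y.
Proof. by rewrite /= sin_angle_mod angleD sinD. Qed.

Lemma angle_sub x : angle (N - x) = - angle x + pi *+ 2.
Proof.
rewrite /angle natrB ?(ltnW (ltn_ord x)) // mulrBr mulrBl.
by rewrite mulfK ?pnatr_eq0 // addrC mulr_natl.
Qed.

Lemma cos_angleN x : cs (- x) = cs x.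
Proof. by rewrite /= cos_angle_mod angle_sub cosD2pi cosN. Qed.

Lemma sin_angleN x : sn (- x) = - sn x.
Proof. by rewrite /= sin_angle_mod angle_sub sinD2pi sinN. Qed.

Lemma cos_angle0 : cs 0 = 1.
Proof. by rewrite /angle mulr0 mul0r cos0. Qed.

Lemma sin_angle0 : sn 0 = 0.
Proof. by rewrite /angle mulr0 mul0r sin0. Qed.

Lemma sin_half_angle_gt0 d : (0 < d < N)%N -> 0 < sin (half_angle d).
Proof.
move=> /andP[d0 dN]; apply: sin_gt0_pi; rewrite /half_angle.
rewrite divr_gt0 ?mulr_gt0 ?pi_gt0 ?ltr0n //=.
by rewrite ltr_pdivrMr ?ltr0n // ltr_pM2l ?pi_gt0 // ltr_nat.
Qed.

Lemma sin_half_angle_ge0 d : (d <= N)%N -> 0 <= sin (half_angle d).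
Proof.
rewrite leq_eqVlt => /predU1P[->|dN].
  by rewrite /half_angle mulfK ?pnatr_eq0 // sinpi.
case: d dN => [|d] dN; first by rewrite /half_angle mulr0 mul0r sin0.
exact/ltW/sin_half_angle_gt0.
Qed.

Lemma cos_h_gt0 : 0 < cos h.
Proof.
apply: cos_gt0_pihalf; apply/andP; split.
  apply: (@lt_le_trans _ _ 0); first by rewrite oppr_lt0 divr_gt0 ?pi_gt0.
  by rewrite /half_angle mulr1 divr_ge0 ?pi_ge0.
rewrite /half_angle mulr1 ltr_pM2l ?pi_gt0 // ltf_pV2 ?posrE ?ltr0n //.
by rewrite ltr_nat.
Qed.

Lemma cos_angle_half d : cos (angle d) = 1 - 2 * sin (half_angle d) ^+ 2.
Proof. by rewrite angleE cosD -!expr2 cos2sin2; ring. Qed.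

Lemma sin_angle_half d :
  sin (angle d) = 2 * sin (half_angle d) * cos (half_angle d).
Proof. by rewrite angleE sinD; ring. Qed.

Lemma cos_angle_lt1 x : x != 0 -> cs x < 1.
Proof.
move=> x0; rewrite cos_angle_half ltrBlDr ltrDl mulr_gt0 // exprn_gt0 //.
by rewrite sin_half_angle_gt0 // ltn_ord andbT lt0n.
Qed.

(** The form whose direction is the midpoint of the edge from 0 to 1 is maximal
    on this edge only:
    [cos h - cos ((2 x - 1) h) = 2 sin (x h) sin ((x - 1) h)]. *)
Lemma edge_functional x : x != 0 -> x != 1 ->
  cs x * cos h + sn x * sin h < cos h.
Proof.
move=> x0 x1; have xv0 : (x != 0%N :> nat) by [].
have xv1 : (x != 1%N :> nat) by [].
have [d dE] : exists d, nat_of_ord x = d.+2.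
  by case: (nat_of_ord x) xv0 xv1 => [|[|d]] // _ _; exists d.
have dN : (d.+2 < N)%N by rewrite -dE.
have s2 : 0 < sin (half_angle d.+2) by rewrite sin_half_angle_gt0.
have s1 : 0 < sin (half_angle d.+2 - h).
  by rewrite (half_angleS d.+1) addrK sin_half_angle_gt0 //= ltnW.
rewrite sinB in s1.
rewrite dE cos_angle_half sin_angle_half -subr_gt0.
rewrite (_ : _ - _ = 2 * sin (half_angle d.+2) *
  (sin (half_angle d.+2) * cos h - cos (half_angle d.+2) * sin h)); last by ring.
by rewrite !mulr_gt0.
Qed.

Definition polygon_form (p q : R) x : R := p * cs x + q * sn x.

(** For a vertex, the form points to this vertex; for an edge, to its midpoint.
    A rotation brings [i] to 0. *)
Lemma seg_exposed b i : exists p q r : R, forall m,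
  polygon_form p q m <= r ?= iff (m \in seg b i).
Proof.
pose p := if b then cs i * cos h - sn i * sin h else cs i.
pose q := if b then sn i * cos h + cs i * sin h else sn i.
exists p, q, (if b then cos h else 1) => m; rewrite /polygon_form; apply/leifP.
have -> : m = (m - i) + i by rewrite subrK.
move: (m - i) => {m}x.
have cE : p * cs (x + i) + q * sn (x + i) =
    if b then cs x * cos h + sn x * sin h else cs x.
  have i1 : cs i ^+ 2 + sn i ^+ 2 = 1 by rewrite cos2Dsin2.
  rewrite /p /q cos_angleD sin_angleD; clear p q.
  by case: b => /=; [transitivity ((cs x * cos h + sn x * sin h) *
    (cs i ^+ 2 + sn i ^+ 2)) | transitivity (cs x * (cs i ^+ 2 + sn i ^+ 2))];
    first [by rewrite /=; ring | by rewrite i1 mulr1].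
rewrite cE /seg; clear p q cE; case: b.
  rewrite !inE ordS_add1 addrC -{2}[i]addr0 !(inj_eq (addrI _)).
  have [->|x0] := eqVneq x 0.
    by rewrite cos_angle0 sin_angle0 mul1r mul0r addr0 eqxx.
  have [->|x1] := eqVneq x 1; last exact: edge_functional.
  apply/eqP; rewrite angleE cosD sinD.
  have := cos2Dsin2 h; rewrite !expr2 => E.
  transitivity (cos h * (cos h * cos h + sin h * sin h)); first by ring.
  by rewrite E mulr1.
rewrite !inE addrC -{2}[i]addr0 (inj_eq (addrI _)).
have [->|x0] := eqVneq x 0; first by rewrite cos_angle0.
exact: cos_angle_lt1.
Qed.

(** A polygon is convex: seen from the vertex [i], any other vertex is in the
    cone spanned by the two neighbours of [i]. After a rotation to [i = 0], with
    [F d] the value at [d] and [h] half the central angle, this is the identity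
    [2 (sin h)^2 (cos h) (F 0 - F d) = sin (d h) (sin ((d + 1) h) (F 0 - F 1)
     + sin ((d - 1) h) (F 0 - F (- 1)))],
    whose coefficients are nonnegative and do not both vanish. *)
Lemma local_max_global (p q : R) i m :
    polygon_form p q (i + 1) < polygon_form p q i ->
    polygon_form p q (i - 1) < polygon_form p q i ->
  m != i -> polygon_form p q m < polygon_form p q i.
Proof.
rewrite /polygon_form.
pose p' := p * cs i + q * sn i; pose q' := q * cs i - p * sn i.
have rot x : p * cs (i + x) + q * sn (i + x) = p' * cs x + q' * sn x.
  by rewrite cos_angleD sin_angleD /p' /q' /=; ring.
have -> : m = i + (m - i) by rewrite addrC subrK.
move: (m - i) => x f1 f2.
rewrite -[X in _ != X]addr0 (inj_eq (addrI _)) => x0; move: f1 f2.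
rewrite !rot -/p' cos_angleN sin_angleN (_ : nat_of_ord (1 : I) = 1%N) //.
have [d dE] : exists d, nat_of_ord x = d.+1.
  by exists (nat_of_ord x).-1; rewrite prednK // lt0n.
have dN : (d.+1 < N)%N by rewrite -dE ltn_ord.
rewrite dE !cos_angle_half !sin_angle_half.
set S := sin h; set C := cos h.
have S0 : 0 < S by exact: sin_half_angle_gt0.
have C0 : 0 < C by exact: cos_h_gt0.
set s := sin (half_angle d.+1); set c := cos (half_angle d.+1).
have s0 : 0 < s by rewrite sin_half_angle_gt0.
have sD : 0 <= s * C + c * S.
  by rewrite -sinD -half_angleS sin_half_angle_ge0.
have dE' : half_angle d = half_angle d.+1 - h by rewrite half_angleS addrK.
have sB : 0 <= s * C - c * S.
  by rewrite -sinB -dE' sin_half_angle_ge0 // ltnW // ltnW.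
have sDB : 0 < s * C + c * S \/ 0 < s * C - c * S.
  rewrite -sinD -sinB -half_angleS -dE'.
  case: d {dE s c s0 sD dE' sB} dN => [|d] dN; [left|right].
    exact: sin_half_angle_gt0.
  by rewrite sin_half_angle_gt0 //= ltnW.
move=> f1 f2.
have a0 : 0 < p' * S - q' * C.
  by rewrite -(pmulr_rgt0 _ S0); move: f1; rewrite -subr_gt0; lra.
have b0 : 0 < p' * S + q' * C.
  by rewrite -(pmulr_rgt0 _ S0); move: f2; rewrite -subr_gt0; lra.
(* [a0] and [b0] are [F 0 - F 1] and [F 0 - F (- 1)] divided by [2 S]. *)
have g0 : 0 < (s * C + c * S) * (p' * S - q' * C)
            + (s * C - c * S) * (p' * S + q' * C).
  by case: sDB => sDB; [apply: ltr_wpDr | apply: ltr_wpDl];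
    rewrite ?mulr_gt0 ?mulr_ge0 // ltW.
have g1 : 0 < p' * s - q' * c.
  have SC : 0 < 2 * S * C by rewrite !mulr_gt0.
  rewrite -(pmulr_rgt0 _ SC); move: g0.
  by congr (0 < _); ring.
rewrite -subr_gt0 (_ : _ - _ = 2 * s * (p' * s - q' * c)); last by ring.
by rewrite !mulr_gt0.
Qed.

Lemma argmax_edge (p q : R) i j :
    (forall x, polygon_form p q x <= polygon_form p q i) ->
    j != i -> polygon_form p q j = polygon_form p q i ->
  exists l : I, forall x, x \in seg true l ->
    polygon_form p q x = polygon_form p q i.
Proof.
move=> max_i ji eq_j.
have [E|N1] := eqVneq (polygon_form p q (i + 1)) (polygon_form p q i).
  by exists i => x; rewrite in_seg ordS_add1 => /orP[]/eqP->.
have [E|N2] := eqVneq (polygon_form p q (i - 1)) (polygon_form p q i).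
  by exists (i - 1) => x; rewrite in_seg ordS_add1 subrK => /orP[]/eqP->.
have := @local_max_global p q i j; rewrite !lt_neqAle N1 N2 !max_i eq_j eqxx.
by move=> /(_ isT isT ji).
Qed.

(** The sum of the values at 1 and - 1 is [2 p cos (2 h)], and [cos (2 h) < 1]. *)
Lemma polygon_form_const (p q : R) :
  (forall x, polygon_form p q x = polygon_form p q 0) -> p = 0 /\ q = 0.
Proof.
rewrite /polygon_form => const; have := const 1; have := const (- 1).
rewrite cos_angleN sin_angleN cos_angle0 sin_angle0 => E1 E2.
have c1 : cs 1 < 1 by apply: cos_angle_lt1.
have s1 : 0 < sn 1.
  by rewrite sin_angle_half !mulr_gt0 ?cos_h_gt0 ?sin_half_angle_gt0.
have : p * (1 - cs 1) = 0 by lra.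
move/eqP; rewrite mulf_eq0 subr_eq0 [1 == _]eq_sym (lt_eqF c1) orbF => /eqP p0.
split=> //; move: E2; rewrite p0 !mul0r mulr0 !add0r => /eqP.
by rewrite mulf_eq0 (gt_eqF s1) orbF => /eqP.
Qed.

Lemma cos_angle_unit_step x y : unit_step x -> cs (x * y) = cs y.
Proof. by case/orP=> /eqP->; rewrite ?mul1r // mulN1r cos_angleN. Qed.

End Circle.

(** * Exposed faces of a polytope *)

Section Exposed.
Variables (R : realType) (N : nat) (T : finType) (M : T -> 'rV[R]_N).
Implicit Types (c : {set T}) (v : T).

(** The vertex sets of the faces of the convex hull of the family, the empty set
    and the whole set included. *)
Definition exposed c : Prop := exists (a : 'rV[R]_N) (b : R),
  forall v, dotp a (M v) <= b ?= iff (v \in c).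

(** Intersecting with the hull of an exposed set amounts to intersecting with
    its supporting hyperplane. *)
Lemma cell_hull_setI c c' : exposed c' ->
  cell_hull M c `&` cell_hull M c' = cell_hull M (c :&: c').
Proof.
case=> a [b ab]; apply/seteqP; split=> [x [cx c'x]|x cx]; last first.
  by split; apply: cell_hullS cx; rewrite ?finset.subsetIl ?finset.subsetIr.
have le_b v : v \in c -> dotp a (M v) <= b by move=> _; case: (ab v).
have xb : dotp a x = b.
  by apply: cell_hull_hyperplane c'x => v; rewrite -(ab v).2 => /eqP.
have : (cell_hull M c `&` [set x | dotp a x = b]) x by [].
rewrite (cell_hull_face le_b); apply: cell_hullS.
by apply/fintype.subsetP => v; rewrite !inE (ab v).2.
Qed.

Lemma hull_range : hull (range M) = cell_hull M [set: T].
Proof. by congr hull; apply/seteqP; split=> _ [v _ <-]; exists v; rewrite //= inE. Qed.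

Lemma exposed_inj : (forall v, exposed [set v]) -> injective M.
Proof.
move=> ex u v; case: (ex u) => a [b ab] uv.
by have := (ab v).2; rewrite -uv (ab u).2 !inE eqxx => /esym/eqP.
Qed.

Lemma exposed_proper_face c v v' : exposed c -> v \in c -> v' \notin c ->
  proper_face (hull (range M)) (cell_hull M c).
Proof.
move=> [a [b ab]] vc v'c; split.
- by exists (M v); apply: cell_hull_vertex.
- move=> E; have : cell_hull M c (M v') by rewrite E; apply: sub_hull; exists v'.
  move/(@cell_hull_hyperplane _ _ _ _ c a b) => H.
  by move: v'c; rewrite -(ab v').2 H ?eqxx // => u; rewrite -(ab u).2 => /eqP.
- exists a, b; rewrite hull_range; split.
    by apply: dotp_cell_hull => u _; case: (ab u).
  rewrite [RHS](_ : _ = cell_hull M [set: T] `&` [set x | dotp a x = b]) //.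
  rewrite cell_hull_face => [|u _]; last by case: (ab u).
  by congr (cell_hull M _); apply/setP=> u; rewrite !inE (ab u).2.
Qed.

Lemma proper_face_exposed (F : set 'rV[R]_N) : proper_face (hull (range M)) F ->
  exists c, [/\ exposed c, F = cell_hull M c & exists v, v \in c].
Proof.
move=> [[x Fx] _ [a [b [ab FE]]]].
have vb v : dotp a (M v) <= b by apply: ab; apply: sub_hull; exists v.
pose c := [set v | dotp a (M v) == b]%SET.
have cF : F = cell_hull M c.
  rewrite FE hull_range.
  rewrite [LHS](_ : _ = cell_hull M [set: T] `&` [set x | dotp a x = b]) //.
  rewrite cell_hull_face => [|u _]; last exact: vb.
  by congr (cell_hull M _); apply/setP=> u; rewrite !inE.
exists c; split=> //.
  by exists a, b => v; apply/leifP; rewrite inE lt_def eq_sym vb; case: eqP.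
apply/set0Pn/eqP => c0; move: Fx; rewrite cF c0 => /cell_hullP[w [_ w0 w1 _]].
move: (oner_neq0 R); rewrite -w1 big1 ?eqxx // => v _; apply: w0.
by rewrite inE.
Qed.

Lemma affdim_cell_hull c v0 d (B : 'M[R]_(d, N)) :
    v0 \in c -> row_free B ->
    (forall i, exists2 v, v \in c & row i B = M v - M v0) ->
    (forall v, v \in c -> (M v - M v0 <= B)%MS) ->
  affdim (cell_hull M c) d.
Proof.
move=> v0c fB rB subB; exists (M v0), B; split=> //.
- exact: cell_hull_vertex.
- by move=> i; case: (rB i) => v vc ->; rewrite addrC subrK; apply: cell_hull_vertex.
move=> y /cell_hullP[w [_ wc w1 ->]].
rewrite -[M v0]scale1r -w1 scaler_suml -sumrB.
apply: summx_sub => v _; have [vc|/wc->] := boolP (v \in c).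
  by rewrite -scalerBr scalemx_sub // subB.
by rewrite !scale0r subr0 sub0mx.
Qed.

(** The hyperplane that exposes [c] contains the line through [M v0] and [M v1]
    but not [M v2], so the three points are not on a line. *)
Lemma exposed_row_free c v0 v1 v2 : exposed c ->
    v0 \in c -> v1 \in c -> v2 \notin c -> M v1 != M v0 ->
  row_free (col_mx (M v1 - M v0) (M v2 - M v0)).
Proof.
move=> [a [b ab]] v0c v1c v2c; rewrite -subr_eq0 => v10.
have in_b v : (dotp a (M v) == b) = (v \in c) := (ab v).2.
have [a0 a1] : dotp a (M v0) = b /\ dotp a (M v1) = b.
  by split; apply/eqP; rewrite in_b.
rewrite -kermx_eq0; apply/eqP/row_matrixP => i; rewrite row0.
have : row i (kermx (col_mx (M v1 - M v0) (M v2 - M v0))) *m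
    col_mx (M v1 - M v0) (M v2 - M v0) = 0.
  by rewrite -row_mul mulmx_ker row0.
move: (row i _) => u; rewrite -[u]hsubmxK mul_row_col.
rewrite [lsubmx u]mx11_scalar [rsubmx u]mx11_scalar !mul_scalar_mx.
move: (lsubmx u 0 0) (rsubmx u 0 0) => l r E.
have r0 : r = 0.
  have : dotp a (l *: (M v1 - M v0) + r *: (M v2 - M v0)) = 0.
    by rewrite E -(scale0r (0 : 'rV[R]_N)) dotpZr mul0r.
  rewrite dotpDr !dotpZr !dotpBr a0 a1 subrr mulr0 add0r => /eqP.
  by rewrite mulf_eq0 subr_eq0 in_b (negPf v2c) orbF => /eqP.
move/eqP: E; rewrite r0 scale0r addr0 scaler_eq0 (negPf v10) orbF => /eqP->.
by apply/rowP => j; rewrite !mxE; case: splitP => ? _; rewrite !mxE mul0rn.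
Qed.

Lemma affdim_exposed c F d v0 v1 v2 : affdim F d -> (d <= 1)%N -> exposed c ->
    v0 \in c -> v1 \in c -> v2 \notin c -> M v1 != M v0 ->
  F (M v0) -> F (M v1) -> ~ F (M v2).
Proof.
move=> [x [B [_ _ _ FB]]] d1 ex v0c v1c v2c v10 F0 F1 F2.
have sub v : F (M v) -> (M v - M v0 <= B)%MS.
  move=> Fv; have -> : M v - M v0 = (M v - x) - (M v0 - x).
    by rewrite opprB addrA subrK.
  by rewrite addmx_sub ?eqmx_opp ?FB.
have := mxrankS (_ : (col_mx (M v1 - M v0) (M v2 - M v0) <= B)%MS).
rewrite col_mx_sub !sub // => /(_ isT).
have /eqP -> := exposed_row_free ex v0c v1c v2c v10.
by move/leq_trans => /(_ _ (rank_leq_row B)) /leq_trans /(_ d1).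
Qed.

End Exposed.

(** * Symmetries from Gram matrices *)

Section Symmetry.
Variables (R : realType) (N : nat) (T : finType) (M : T -> 'rV[R]_N).

(** Spanning as a vector space, in the dual form. *)
Definition spanning : Prop :=
  forall c : 'rV[R]_N, (forall v, dotp c (M v) = 0) -> c = 0.

Lemma mulmx_trmx_eq0 m (X : 'M[R]_(m, N)) : X *m X^T = 0 -> X = 0.
Proof.
move=> X0; apply/matrixP => i j; rewrite mxE; apply/eqP.
have : \sum_l X i l ^+ 2 == 0.
  apply/eqP; move: (congr1 (fun Y : 'M[R]_m => Y i i) X0); rewrite !mxE => E.
  by rewrite -[RHS]E; apply: eq_bigr => l _; rewrite mxE expr2.
rewrite psumr_eq0 => [/allP/(_ j)|l _]; last exact: sqr_ge0.
by rewrite mem_index_enum sqrf_eq0 => /(_ isT).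
Qed.

(** The Gram matrix determines a family up to an orthogonal map. With [B] and [C]
    the matrices whose rows are the family and its permutation, the only
    candidate is [A = B^+ C], for a left inverse [B^+] of [B]. As
    [C C^T = B B^T], the matrix [X = B A - C = (B B^+ - 1) C] satisfies
    [X X^T = 0]. *)
Lemma gram_orthogonal (s : T -> T) : spanning ->
    (forall u v, dotp (M (s u)) (M (s v)) = dotp (M u) (M v)) ->
  exists2 A : 'M[R]_N, A *m A^T = 1%:M & forall v, M v *m A = M (s v).
Proof.
move=> span gram.
pose B := \matrix_(i < #|T|) M (enum_val i).
pose C := \matrix_(i < #|T|) M (s (enum_val i)).
have BC : C *m C^T = B *m B^T.
  apply/matrixP => i j; rewrite -[LHS]/((C *m C^T) i j).
  transitivity (dotp (M (s (enum_val i))) (M (s (enum_val j)))).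
    by rewrite mxE; apply: eq_bigr => l _; rewrite !mxE.
  by rewrite gram mxE; apply: eq_bigr => l _; rewrite !mxE.
have fullB : row_full B.
  rewrite /row_full -mxrank_tr -/(row_free B^T) -kermx_eq0.
  apply/eqP/row_matrixP => i; rewrite row0; apply: span => v.
  have : row i (kermx B^T) *m B^T = 0 by rewrite -row_mul mulmx_ker row0.
  move/(congr1 (fun Y : 'rV[R]_#|T| => Y 0 (enum_rank v))); rewrite !mxE => E.
  rewrite -[RHS]E; apply: eq_bigr => l _.
  by rewrite !mxE enum_rankK.
have pB : pinvmx B *m B = 1%:M by apply: mulVpmx.
have BpB : B *m pinvmx B *m B = B by rewrite -mulmxA pB mulmx1.
have CE : B *m (pinvmx B *m C) = C.
  apply/eqP; rewrite -subr_eq0; apply/eqP/mulmx_trmx_eq0.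
  have -> : B *m (pinvmx B *m C) - C = (B *m pinvmx B - 1%:M) *m C.
    by rewrite mulmxBl mul1mx mulmxA.
  rewrite trmx_mul mulmxA -[_ *m C *m C^T]mulmxA BC.
  by rewrite mulmxA mulmxBl BpB mul1mx subrr !mul0mx.
exists (pinvmx B *m C).
  rewrite trmx_mul mulmxA -[pinvmx B *m C *m C^T]mulmxA BC mulmxA pB mul1mx.
  by rewrite -trmx_mul pB trmx1.
move=> v; have := congr1 (row (enum_rank v)) CE.
by rewrite row_mul !rowK enum_rankK.
Qed.

(** Automorphisms are only required to map cells to cells; as there are finitely
    many of them, every cell is reached. *)
Lemma automorphism_surj (K : complex T) (s : {perm T}) d c : automorphism K s ->
  c \in K d -> exists e, exists2 c', c' \in K e & c = s @: c'.
Proof.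
move=> sK cd; pose cells := [set c : {set T} | `[< exists e, c \in K e >]]%SET.
have cellsP (A : {set T}) : reflect (exists e, A \in K e) (A \in cells).
  by rewrite inE; apply: asboolP.
have sI : injective (fun c : {set T} => s @: c) by apply: imset_inj; apply: perm_inj.
have E : [set s @: (c : {set T}) | c in cells]%SET = cells.
  apply/eqP; rewrite eqEcard card_imset // leqnn andbT.
  apply/fintype.subsetP => _ /imsetP[c' /cellsP[e c'e] ->].
  by apply/cellsP; apply: sK c'e.
have : c \in cells by apply/cellsP; exists d.
by rewrite -E => /imsetP[c' /cellsP[e c'e] ->]; exists e, c'.
Qed.

Lemma gram_without_hidden_symmetries (K : complex T) : spanning ->
    (forall s : {perm T}, automorphism K s ->
       forall u v, dotp (M (s u)) (M (s v)) = dotp (M u) (M v)) ->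
  without_hidden_symmetries K M (realization K M).
Proof.
move=> span gram s sK.
have [A A1 MA] := gram_orthogonal span (gram s sK).
exists (fun x => x *m A) => //; split.
  move=> x y; rewrite /Defs.edist -mulmxBl !dotpE trmx_mul mulmxA.
  by rewrite -[_ *m A *m A^T]mulmxA A1 mulmx1.
apply/seteqP; split=> [_ [_ [d [c cd ->]] <-]|_ [d [c cd ->]]].
  have [e ce] := sK d c cd; exists e, (s @: c) => //.
  exact: (cell_hull_image _ MA).
have [e [c' ce ->]] := automorphism_surj sK cd.
exists (cell_hull M c'); first by exists e, c'.
exact: (cell_hull_image _ MA).
Qed.

End Symmetry.

(** * The duoprism *)

Section Duoprism.
Variables (R : realType) (n k : nat).
Local Notation V := ('I_n.+3 * 'I_k.+3)%type.
Local Notation M := (@duoprism_vertex R n.+3 k.+3).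
Local Notation Quad := (@torus_quadrangulation n.+3 k.+3).
Local Notation torus := (@torus_graph n.+3 k.+3).
Local Notation csn x := (cos (angle R n x)).
Local Notation snn x := (sin (angle R n x)).
Local Notation csk x := (cos (angle R k x)).
Local Notation snk x := (sin (angle R k x)).
Implicit Types (u v p : V) (c : {set V}).

Definition vec4 (p q r t : R) : 'rV[R]_4 := \row_l [:: p; q; r; t]`_l.

Lemma vertexE v : M v = vec4 (csn v.1) (snn v.1) (csk v.2) (snk v.2).
Proof. by []. Qed.

Lemma vec4_surj (x : 'rV[R]_4) : exists p q r t : R, x = vec4 p q r t.
Proof.
exists (x 0 0), (x 0 1), (x 0 2%:R), (x 0 3%:R); apply/rowP => i; rewrite mxE.
by case: i => [[|[|[|[|i]]]] lt_i] //=; congr (x _ _); apply: val_inj.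
Qed.

Lemma dotp_vec4 (p q r t p' q' r' t' : R) :
  dotp (vec4 p q r t) (vec4 p' q' r' t') = p * p' + q * q' + (r * r' + t * t').
Proof. by rewrite /dotp !big_ord_recl big_ord0 !mxE /= addr0 !addrA. Qed.

Lemma gramE u v :
  dotp (M u) (M v) = csn (u.1 - v.1)%R + csk (u.2 - v.2)%R.
Proof.
by rewrite !vertexE dotp_vec4 !cos_angleD !cos_angleN !sin_angleN !mulrN !opprK.
Qed.

(** Exposing forms on the two factors add up. *)
Lemma box_exposed (b1 b2 : bool) p : exposed M (box b1 b2 p).
Proof.
have [p1 [q1 [r1 H1]]] := seg_exposed R b1 p.1.
have [p2 [q2 [r2 H2]]] := seg_exposed R b2 p.2.
exists (vec4 p1 q1 p2 q2), (r1 + r2) => v.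
by rewrite vertexE dotp_vec4 in_box; exact: leifD (H1 v.1) (H2 v.2).
Qed.

Lemma vertex_inj : injective M.
Proof. by apply: exposed_inj => v; rewrite -box_vertex; apply: box_exposed. Qed.

Lemma cell_exposed d c : c \in Quad d -> exposed M c.
Proof. by case/cellP=> [b1 [b2 [p [-> _]]]]; apply: box_exposed. Qed.

Lemma ordS_neq m (i : 'I_m.+3) : ordS i != i.
Proof. by rewrite ordS_add1 -[X in _ != X]addr0 (inj_eq (addrI _)). Qed.

Lemma ordSS_neq m (i : 'I_m.+3) : ordS (ordS i) != i.
Proof. by rewrite !ordS_add1 -addrA -[X in _ != X]addr0 (inj_eq (addrI _)). Qed.

Lemma cell_proper_face d c : c \in Quad d ->
  proper_face (@duoprism R n.+3 k.+3) (cell_hull M c).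
Proof.
case/cellP=> [b1 [b2 [p [-> _]]]].
apply: (@exposed_proper_face _ _ _ _ _ p (ordS (ordS p.1), p.2)).
- exact: box_exposed.
- by rewrite in_box !in_seg !eqxx.
rewrite in_box !in_seg /= (negPf (ordSS_neq _)) /=.
by rewrite (inj_eq (can_inj (@ordSK _))) (negPf (ordS_neq _)) andbF.
Qed.

Lemma parallelogram i i' j j' : M (i', j') - M (i, j) =
  (M (i', j) - M (i, j)) + (M (i, j') - M (i, j)).
Proof.
apply/rowP => l; rewrite !vertexE /= !mxE.
by case: l => [[|[|[|[|l]]]] lt_l] //=; ring.
Qed.

Lemma cell_affdim d c : c \in Quad d -> affdim (cell_hull M c) d.
Proof.
have free1 u v : u != v -> row_free (M u - M v).
  by move=> uv; rewrite /row_free rank_rV subr_eq0 (inj_eq vertex_inj) uv.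
have edge u v : u != v -> affdim (cell_hull M [set v; u]) 1.
  move=> uv; apply: (@affdim_cell_hull _ _ _ _ _ v _ (M u - M v)) => //.
  - by rewrite !inE eqxx.
  - exact: free1.
  - by move=> i; exists u; rewrite ?row_id // !inE eqxx orbT.
  by move=> w; rewrite !inE => /orP[]/eqP-> //; rewrite subrr sub0mx.
case/cellP=> [[] [[] [[i j] [-> ->]]]] /=.
- set p := (i, j); set q1 := (ordS i, j); set q2 := (i, ordS j).
  apply: (@affdim_cell_hull _ _ _ _ _ p _ (col_mx (M q1 - M p) (M q2 - M p))).
  + by rewrite in_box !in_seg !eqxx.
  + apply: (exposed_row_free (box_exposed true false p)).
    * by rewrite in_box !in_seg !eqxx.
    * by rewrite in_box !in_seg !eqxx orbT.
    * by rewrite in_box !in_seg /= (negPf (ordS_neq j)) andbF.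
    * by rewrite (inj_eq vertex_inj) vertex_eqE negb_and ordS_neq.
  + move=> l; case: (split_ordP l) => l' ->; rewrite ?rowKu ?rowKd row_id.
      by exists q1; rewrite // in_box !in_seg !eqxx orbT.
    by exists q2; rewrite // in_box !in_seg !eqxx orbT.
  move=> [x y]; rewrite in_box !in_seg /= => /andP[] /orP[]/eqP-> /orP[]/eqP->.
  + by rewrite subrr sub0mx.
  + by rewrite -addsmxE addsmxSr.
  + by rewrite -addsmxE addsmxSl.
  + by rewrite parallelogram addmx_sub // -addsmxE ?addsmxSl ?addsmxSr.
- by rewrite box_horizontal; apply: edge; rewrite vertex_eqE negb_and ordS_neq.
- by rewrite box_vertical; apply: edge; rewrite vertex_eqE negb_and ordS_neq orbT.
rewrite box_vertex; apply: (@affdim_cell_hull _ _ _ _ _ (i, j) _ 0).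
- by rewrite inE.
- by rewrite /row_free mxrank0.
- by case.
by move=> v; rewrite inE => /eqP->; rewrite subrr sub0mx.
Qed.

(** An exposed set is the product of the maximizers on the two polygons; a factor
    that is not a singleton contains an edge of its polygon, by
    [argmax_edge]. *)
Lemma exposed_edge c u v : exposed M c -> u \in c -> v \in c -> u != v ->
  exists2 e, e \in Quad 1 & e \subset c.
Proof.
move=> [a [b]]; have [p [q [r [t ->]]]] := vec4_surj a => ab uc vc uv.
have ac x : (dotp (vec4 p q r t) (M x) == b) = (x \in c) := (ab x).2.
pose f (x : 'I_n.+3) := polygon_form p q x.
pose g (y : 'I_k.+3) := polygon_form r t y.
have E x : dotp (vec4 p q r t) (M x) = f x.1 + g x.2.
  by rewrite vertexE dotp_vec4.
have ub : f u.1 + g u.2 = b by apply/eqP; rewrite -E ac.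
have vb : f v.1 + g v.2 = b by apply/eqP; rewrite -E ac.
have le_b x y : f x + g y <= b by have := (ab (x, y)).1; rewrite E.
have fmax x : f x <= f u.1 by have := le_b x u.2; rewrite -ub lerD2r.
have gmax y : g y <= g u.2 by have := le_b u.1 y; rewrite -ub lerD2l.
have [fv gv] : f v.1 = f u.1 /\ g v.2 = g u.2.
  by have := fmax v.1; have := gmax v.2; split; lra.
have [uv1|uv1] := eqVneq v.1 u.1; last first.
  have [l fl] := argmax_edge fmax uv1 fv; exists (box true false (l, u.2)).
    by apply/cellP; exists true, false, (l, u.2).
  apply/fintype.subsetP => -[x y]; rewrite in_box -ac E /= => /andP[/fl fx].
  by rewrite inE => /eqP->; rewrite [X in X + _]fx -ub.
have uv2 : v.2 != u.2.
  by apply: contraNneq uv => uv2; rewrite vertex_eqE uv1 uv2 !eqxx.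
have [l gl] := argmax_edge gmax uv2 gv; exists (box false true (u.1, l)).
  by apply/cellP; exists false, true, (u.1, l).
apply/fintype.subsetP => -[x y]; rewrite in_box -ac E /= => /andP[+ /gl gy].
by rewrite inE => /eqP->; rewrite [X in _ + X]gy -ub.
Qed.

(** A face that is not a vertex contains an edge by [exposed_edge]; a further
    vertex would raise its dimension to 2. *)
Lemma low_face_cell F d : (d <= 1)%N -> affdim F d ->
    proper_face (@duoprism R n.+3 k.+3) F ->
  exists e, exists2 c, c \in graph_complex torus e & F = cell_hull M c.
Proof.
move=> d1 Fd /proper_face_exposed[c [ex FE [v vc]]].
have [cv|/set0Pn] := eqVneq (c :\ v)%SET finset.set0.
  exists 0%N, c => //; apply/graph_cellP; split=> //.
  apply/cellP; exists false, false, v; split=> //; rewrite box_vertex.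
  by rewrite -(finset.setD1K vc) cv finset.setU0.
case=> u; rewrite !inE => /andP[uv uc].
have [e eK ec] := exposed_edge ex uc vc uv.
exists 1%N, e; first by apply/graph_cellP.
rewrite FE; congr (cell_hull M _); apply/esym/eqP; rewrite finset.eqEsubset ec.
apply/fintype.subsetP => w wc; apply/negPn/negP => we.
have /card_gt1P[x [y [xe ye xy]]] : (1 < #|e|)%N.
  by case/cellP: (eK) => [b1 [b2 [p [-> E]]]]; rewrite card_box -E.
have Fc z : z \in c -> F (M z) by rewrite FE; apply: cell_hull_vertex.
apply: (affdim_exposed Fd d1 (cell_exposed eK) ye xe we).
- by rewrite (inj_eq vertex_inj).
- by apply: Fc; apply: (fintype.subsetP ec).
- by apply: Fc; apply: (fintype.subsetP ec).
- exact: Fc.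
Qed.

(** A linear form that vanishes on all vertices is constant on each polygon,
    hence zero. *)
Lemma vertices_span : spanning M.
Proof.
move=> c; have [p [q [r [t ->]]]] := vec4_surj c => c0.
have E (x : 'I_n.+3) (y : 'I_k.+3) : polygon_form p q x + polygon_form r t y = 0.
  by rewrite -(c0 (x, y)) vertexE dotp_vec4.
have [|-> ->] := @polygon_form_const R n p q.
  by move=> x; have := E x 0; have := E 0 0; lra.
have [|-> ->] := @polygon_form_const R k r t.
  by move=> y; have := E 0 y; have := E 0 0; lra.
by apply/rowP => l; rewrite !mxE; case: l => [[|[|[|[|l]]]] lt_l].
Qed.

End Duoprism.

Lemma cos_angle4 (R : realType) (x : 'I_4) :
  cos (angle R 1 x) = 1 - (cycle4_dist x)%:R.
Proof.
have a2 : angle R 1 2 = pi by rewrite /angle; field.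
have a1 : angle R 1 1 = pi / 2 by rewrite /angle; field.
case: x => [[|[|[|[|x]]]] lt_x] //=; rewrite /cycle4_dist /=.
- by rewrite /angle mulr0 mul0r cos0 subr0.
- by rewrite a1 cos_pihalf subrr.
- by rewrite a2 cospi; ring.
- by rewrite (angleD R 1 1 2) a1 a2 cosDpi cos_pihalf oppr0 subrr.
Qed.

(** In the tesseract the inner products of vertices are determined by their graph
    distance. *)
Lemma tesseract_gram (R : realType) (u v : 'I_4 * 'I_4) :
  dotp (duoprism_vertex R u) (duoprism_vertex R v)
  = 2 - (torus4_dist (u - v)%R)%:R.
Proof. by rewrite gramE !cos_angle4 /torus4_dist natrD; ring. Qed.

Lemma vertex_walk n k (u : 'I_n.+3 * 'I_k.+3) :
  e1 n k *+ u.1 + e2 n k *+ u.2 = u.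
Proof.
have walk m m' (x : 'I_m.+3) (y : 'I_m'.+3) i : (x, y) *+ i = (x *+ i, y *+ i).
  by elim: i => // i IH; rewrite !mulrS IH.
case: u => i j; rewrite /e1 /e2 !walk !mul0rn.
by rewrite -[X in _ = (X, _)]natr_Zp -[X in _ = (_, X)]natr_Zp; congr pair;
  rewrite ?add0r ?addr0.
Qed.

(** If each axis goes to itself, the increments [s u - s v] and [u - v] agree up to
    signs. If the axes are exchanged, then [n = k]: going once around one cycle
    gives a closed walk around the other, so each length divides the other.
    The signs disappear in the cosines. *)
Lemma affine_automorphism_gram (R : realType) n k
    (s : 'I_n.+3 * 'I_k.+3 -> 'I_n.+3 * 'I_k.+3) a b :
    perp a b ->
    (forall i j : nat, s (e1 n k *+ i + e2 n k *+ j) = s 0 + (a *+ i + b *+ j)) ->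
  forall u v, dotp (duoprism_vertex R (s u)) (duoprism_vertex R (s v)) =
    dotp (duoprism_vertex R u) (duoprism_vertex R v).
Proof.
move=> /perpP[x [y [xP yP ab]]] s_affine.
have walk m m' (z : 'I_m.+3 * 'I_m'.+3) i : z *+ i = (z.1 *+ i, z.2 *+ i).
  by case: z => z t; elim: i => // i IH; rewrite !mulrS IH.
have natM m (z t : 'I_m.+3) : z *+ t = z * t.
  by rewrite -mulr_natr natr_Zp.
have sE u : s u = s 0 + (a *+ u.1 + b *+ u.2).
  by rewrite -{1}[u]vertex_walk s_affine.
have diff m (z t t' w : 'I_m.+3) : (w + z *+ t) - (w + z *+ t') = z * (t - t').
  by rewrite opprD addrACA subrr add0r !natM -mulrBr.
have s1 u : (s u).1 = (s 0).1 + (a.1 *+ u.1 + b.1 *+ u.2) by rewrite sE !walk.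
have s2 u : (s u).2 = (s 0).2 + (a.2 *+ u.1 + b.2 *+ u.2) by rewrite sE !walk.
case: ab => -[aE bE].
  move=> u v; rewrite !gramE (s1 u) (s1 v) (s2 u) (s2 v) aE bE.
  rewrite !mul0rn !addr0 !add0r !diff.
  by rewrite !cos_angle_unit_step.
have dvd m m' (z : 'I_m.+3) : unit_step z -> z *+ m'.+3 = 0 -> (m <= m')%N.
  move=> zP z0; have : m'.+3%:R == 0 :> 'I_m.+3.
    case/orP: zP z0 => /eqP-> => [->//|].
    by rewrite mulNrn => /eqP; rewrite oppr_eq0.
  rewrite Zp_nat -val_eqE /= => /dvdn_leq.
  by rewrite !ltnS; apply.
have nk : n = k.
  have char m : m.+3%:R = 0 :> 'I_m.+3.
    by rewrite Zp_nat; apply: val_inj; rewrite /= modnn.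
  have N0 : e1 n k *+ n.+3 = 0 by rewrite walk mul0rn [1 *+ _]char.
  have K0 : e2 n k *+ k.+3 = 0 by rewrite walk mul0rn [1 *+ _]char.
  apply/eqP; rewrite eqn_leq; apply/andP; split.
    apply: (dvd _ _ x xP); have := s_affine 0%N k.+3.
    rewrite K0 !mulr0n !addr0 !add0r -[LHS]addr0 => /addrI/(congr1 fst).
    by rewrite bE walk.
  apply: (dvd _ _ y yP); have := s_affine n.+3 0%N.
  rewrite N0 !mulr0n !addr0 -[LHS]addr0 => /addrI/(congr1 snd).
  by rewrite aE walk.
subst k => u v; rewrite !gramE (s1 u) (s1 v) (s2 u) (s2 v) aE bE.
rewrite !mul0rn !addr0 !add0r !diff.
by rewrite !cos_angle_unit_step // addrC.
Qed.

(** All automorphisms are affine for [perp_preserving_affine], except in the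
    tesseract, which has automorphisms mixing the two polygons. *)
Lemma graph_automorphism_gram (R : realType) n k (s : {perm 'I_n.+3 * 'I_k.+3}) :
  automorphism (graph_complex (@torus_graph n.+3 k.+3)) s ->
  forall u v, dotp (duoprism_vertex R (s u)) (duoprism_vertex R (s v)) =
    dotp (duoprism_vertex R u) (duoprism_vertex R v).
Proof.
move=> sK u v.
have s_adj := (graph_automorphismP s (@torus_sym n k) (@torus_irr n k)).1 sK.
have [nk|nk] := eqVneq (n, k) (1%N, 1%N).
  case: nk => n1 k1; subst n k.
  by rewrite !tesseract_gram torus4_dist_automorphism.
have s_step w a := @graph_automorphism_step n k s s_adj w a.
have [[a b] ab s_affine] := perp_preserving_affine (@perm_inj _ s) s_step
  (graph_automorphism_perp s_adj nk).
exact: affine_automorphism_gram ab s_affine u v.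
Qed.

Theorem theorem1 (R : realType) (n k : nat) (hn : (3 <= n)%N) (hk : (3 <= k)%N) :
  let M := @duoprism_vertex R n k in
  let C := graph_complex (@torus_graph n k) in
  let Q := @torus_quadrangulation n k in
  let P := @duoprism R n k in
  (realizes C M (boundary_skeleton P 1) /\
   without_hidden_symmetries C M (boundary_skeleton P 1)) /\
  [/\ realizes Q M (@Qhat R n k),
      @Qhat R n k `<=` boundary_skeleton P 2
    & without_hidden_symmetries Q M (@Qhat R n k)].
Proof.
move: n k hn hk => [|[|[|n]]] // [|[|[|k]]] // _ _ M C Q P.
have skeleton : boundary_skeleton P 1 = realization C M.
  apply/seteqP; split=> [F [PF [d d1 Fd]]|_ [d [c + ->]]].
    exact: low_face_cell d1 Fd PF.
  case/graph_cellP=> d1 cd; split; first exact: cell_proper_face cd.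
  by exists d => //; apply: cell_affdim.
have Q_realizes : realizes Q M (@Qhat R n.+3 k.+3).
  split=> //; [exact: vertex_inj | exact: cell_affdim |].
  by move=> d1 c1 d2 c2 _ /cell_exposed ex; apply: cell_hull_setI.
have gramC := @graph_automorphism_gram R n k.
split; [split|split=> //].
- case: Q_realizes => M_inj _ dimQ capQ; split=> // [d c /graph_cellP[_ cd]|].
    exact: dimQ.
  move=> d1 c1 d2 c2 /graph_cellP[_ c1Q] /graph_cellP[_ c2Q].
  exact: capQ c1Q c2Q.
- rewrite skeleton; apply: gram_without_hidden_symmetries gramC.
  exact: vertices_span.
- move=> _ [d [c cd ->]]; split; first exact: cell_proper_face cd.
  exists d; last exact: cell_affdim.
  by case/cellP: cd => [[] [[] [p [_ ->]]]].
apply: gram_without_hidden_symmetries => [|s sQ]; first exact: vertices_span.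
exact/gramC/quad_automorphism_graph.
Qed.
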